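(* Let $k\ge2$, $n\ge1$ and let $p_1,\ldots,p_k$ be positive integers. The mapping $\Psi$ is a bijection between labelled rooted $k$-nebulas of size $n$ and type $(p_1,\ldots,p_k)$ and valid biddings of size $n$ and type $(p_1,\ldots,p_k)$.
   Context: $[m]=\{1,\ldots,m\}$; types are taken modulo $k$. A map is a cellular embedding (all faces simply connected) of a connected graph in an oriented compact connected surface without boundary, up to orientation preserving homeomorphism. A bud is a dangling half-edge (not part of a complete edge). A $k$-nebula is a map having a single face, with black and white vertices, edges of types $1,\ldots,k$ and buds of types $1,\ldots,k$, such that (i) each edge joins a black and a white vertex; (ii) each black vertex has degree $k$ (counting buds); (iii) in clockwise order around a black vertex (resp. white vertex) the type of the edges or buds increases (resp. decreases) by one modulo $k$ from one half-edge to the next; (iv) for all $t\in[k]$ the number of buds of type $t$ incident to black vertices (black buds) equals the number of buds of type $t$ incident to white vertices (white buds). It is rooted if one black vertex is distinguished (root vertex). It has size $n$ and type $(p_1,\ldots,p_k)$ if it has $n$ black vertices and $p_t$ black buds of type $t$ for all $t$. It is labelled if its black vertices are given distinct labels in $[n]$ and, for each $t$, its $p_t$ white buds of type $t$ are given distinct labels in $L_t$, where $L_t$ is the set of labels of the $p_t$ black vertices incident to black buds of type $t$. The label of an edge is the label of its black endpoint; hence for every $(t,i)\in[k]\times[n]$ there is exactly one object which is either an edge or a white bud of type $t$ and label $i$. Let $c(t,i)$ be the corner preceding this edge or white bud in clockwise order around its incident white vertex. Turning clockwise around a nebula $N$ means walking around its unique face following its edges, with the edges on the right side of the walker (buds are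 just crossed). For a labelled rooted nebula $N$, this visits each white corner $c(t,i)$ once and so defines a cyclic order on $[k]\times[n]$; the appearance order $\prec_N$ is the total order on $[k]\times[n]$ obtained by declaring $(k,\ell_0)$ to be the greatest element, where $\ell_0$ is the label of the root vertex. Then $\Psi(N)=((\omega_1,\ldots,\omega_k),(R_1,\ldots,R_n))$ where $R_i\subsetneq[k]$ is the set of types of the buds incident to the black vertex labelled $i$, and $\omega_t$ is the permutation of $[n]$ such that $(t,\omega_t(1))\prec_N(t,\omega_t(2))\prec_N\cdots\prec_N(t,\omega_t(n))$. A bidding of size $n$ and type $(p_1,\ldots,p_k)$ is a pair $((\omega_1,\ldots,\omega_k),(R_1,\ldots,R_n))$ where $\omega_1,\ldots,\omega_k$ are permutations of $[n]$ and $R_1,\ldots,R_n$ are strict subsets of $[k]$ such that each $t\in[k]$ belongs to exactly $p_t$ of them. For $t\in[k]$, $R\subsetneq[k]$, let $\alpha(t,R)\in[k]$ be (modulo $k$): $t-1$ if $t\in R$; $t+r$ if $t\notin R$, where $r\ge 0$ is such that $t+1,\ldots,t+r\in R$ and $t+r+1\notin R$. The bidding is valid if the undirected graph with vertex set $[k]$ and with the $k-1$ edges $\{t,\alpha(t,R_{\omega_t(n)})\}$, $t=1,\ldots,k-1$ (loops and multiple edges allowed), is a tree. *)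

(* Defs.v *)
(* The index sets [k] = {1..k} and [n] = {1..n} are the ordinal types 'I_k and
   'I_n, the ordinal of value i standing for i + 1; so "type k" and "omega_t(n)"
   refer to the ordinal of maximal value.  ordS and ord_pred are the cyclic
   successor and predecessor, i.e. t + 1 and t - 1 modulo k. *)
From mathcomp Require Import all_boot all_fingroup.

Set Implicit Arguments.
Unset Strict Implicit.
Unset Printing Implicit Defensive.

Fact ord_last_subproof n (n_gt0 : 0 < n) : n.-1 < n.
Proof. by rewrite ltn_predL. Qed.

Definition ord_last n (n_gt0 : 0 < n) : 'I_n := Ordinal (ord_last_subproof n_gt0).

Definition prebidding (k n : nat) : Type :=
  ({ffun 'I_k -> 'S_n} * {ffun 'I_n -> {set 'I_k}})%type.

(* A map, up to orientation preserving homeomorphism, given by its rotation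
   system: [dart] is the set of half-edges, [cw d] is the half-edge following d
   in clockwise order around the vertex incident to d, and [opp d] is the other
   half of the edge containing d, with opp d = d when d is a bud.  The vertices
   are the cycles of cw.  (The only maps not covered are those with a vertex of
   degree 0, that is, a single vertex and nothing else.) *)
Record budmap := BudMap {
  dart :> finType;
  cw : {perm dart};
  opp : {perm dart};
  oppK : involutive opp;
  map_connected :
    forall x y : dart, connect (fun a b => (b == cw a) || (b == opp a)) x y
}.

Section MapDefs.
Variable M : budmap.

Definition vertex_of (d : M) : {set M} := porbit (cw M) d.
Definition is_bud (d : M) : bool := opp M d == d.

(* The corner preceding the half-edge d in clockwise order around its vertex is
   identified with d.  A walker keeping the edges on his right and standing in
   the corner d follows d to its other end and, turning clockwise around the
   vertex he reaches, gets to the corner between opp d and cw (opp d), which is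
   the corner cw (opp d).  If d is a bud he crosses it and gets to the corner
   cw d = cw (opp d). *)
Definition face_perm : {perm M} := (opp M * cw M)%g.
Definition faces : {set {set M}} := porbits face_perm.

End MapDefs.

(* [black d]: the vertex incident to d is black.  The type of an edge is carried
   by its two halves. *)
Record nebula (k : nat) := Nebula {
  nmap :> budmap;
  one_face : #|faces nmap| = 1;
  black : pred nmap;
  black_vertex : forall d, black (cw nmap d) = black d;
  ty : nmap -> 'I_k;
  ty_edge : forall d, ty (opp nmap d) = ty d;
  edge_bipartite : forall d, ~~ is_bud d -> black (opp nmap d) = ~~ black d;
  black_degree : forall d, black d -> #|vertex_of d| = k;
  black_rotation : forall d, black d -> ty (cw nmap d) = ordS (ty d);
  white_rotation : forall d, ~~ black d -> ty (cw nmap d) = ord_pred (ty d);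
  balanced : forall t : 'I_k,
    #|[set d : nmap | [&& is_bud d, black d & ty d == t]]|
    = #|[set d : nmap | [&& is_bud d, ~~ black d & ty d == t]]|
}.

Section NebulaDefs.
Variables (k : nat) (N : nebula k).

Definition black_vertices : {set {set N}} :=
  [set vertex_of d | d in [set d : N | black d]].
Definition black_buds (t : 'I_k) : {set N} :=
  [set d : N | [&& is_bud d, black d & ty d == t]].
Definition white_buds (t : 'I_k) : {set N} :=
  [set d : N | [&& is_bud d, ~~ black d & ty d == t]].

Definition has_size (n : nat) : Prop := #|black_vertices| = n.
Definition has_type (p : 'I_k -> nat) : Prop := forall t, #|black_buds t| = p t.

End NebulaDefs.

(* Labelled rooted nebulas of size n and type p.  For a half-edge d incident to a
   black vertex, [lab d] is the label of this vertex; for a half of an edge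
   incident to a white vertex, it is the label of the edge; for a white bud, it
   is the label of the bud. *)
Record lrnebula (k n : nat) (p : 'I_k -> nat) := LRNebula {
  neb :> nebula k;
  neb_size : has_size neb n;
  neb_type : has_type neb p;
  root : {set neb};
  root_black : root \in black_vertices neb;
  lab : neb -> 'I_n;
  lab_vertex : forall d, black d -> lab (cw neb d) = lab d;
  lab_vertex_inj : forall d e, black d -> black e -> lab d = lab e ->
    vertex_of d = vertex_of e;
  lab_edge : forall d, lab (opp neb d) = lab d;
  lab_bud : forall t d, d \in white_buds neb t ->
    lab d \in [set lab b | b in black_buds neb t];
  lab_bud_inj : forall t, {in white_buds neb t &, injective lab}
}.

(* Labelled rooted nebulas are considered up to isomorphism. *)
Definition nebula_iso (k n : nat) (p : 'I_k -> nat) (N N' : lrnebula n p) : Prop :=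
  exists f : N -> N',
    [/\ bijective f,
        {morph f : d / cw N d >-> cw N' d} /\ {morph f : d / opp N d >-> opp N' d},
        (forall d, black (f d) = black d) /\ (forall d, ty (f d) = ty d),
        forall d, lab (f d) = lab d
      & f @: root N = root N'].

Section Corners.
Variables (k n : nat) (p : 'I_k -> nat) (N : lrnebula n p).
Implicit Types (d e : N) (t : 'I_k) (i : 'I_n).

Lemma iter_ordS m t : iter m (@ordS k) t = (t + m) %% k :> nat.
Proof.
elim: m => [|m IHm] /=; first by rewrite addn0 modn_small.
by rewrite IHm -addn1 modnDml addn1 addnS.
Qed.

Lemma iter_ordS_onto t t' : exists m, iter m (@ordS k) t = t'.
Proof.
exists (t' + (k - t)); apply: val_inj; rewrite /= iter_ordS addnCA subnKC ?modnDr.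
  by rewrite modn_small.
by rewrite ltnW.
Qed.

Lemma black_iter m d :
  black d -> [/\ black (iter m (cw N) d), ty (iter m (cw N) d) = iter m (@ordS k) (ty d)
               & lab (iter m (cw N) d) = lab d].
Proof.
move=> bd; elim: m => [|m [bm tm lm]] //=.
by rewrite black_vertex black_rotation // lab_vertex // tm lm bm.
Qed.

Lemma ty_vertex_inj d : black d -> {in vertex_of d &, injective (@ty k N)}.
Proof.
move=> bd; apply/imset_injP; rewrite black_degree //.
suff -> : [set ty x | x in vertex_of d] = setT by rewrite cardsT card_ord.
apply/setP=> t; rewrite inE; apply/imsetP.
have [m <-] := iter_ordS_onto (ty d) t.
exists (iter m (cw N) d); last by have [_ ->] := black_iter m bd.
by rewrite -permX mem_porbit.
Qed.

Lemma black_dart_uniq d e :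
  black d -> black e -> ty d = ty e -> lab d = lab e -> d = e.
Proof.
move=> bd be tde lde; apply: (ty_vertex_inj bd) => //; first exact: porbit_id.
by rewrite (lab_vertex_inj bd be lde) porbit_id.
Qed.

Lemma lab_onto i : exists d, black d && (lab d == i).
Proof.
pose L := [set lab d | d in [set d : N | black d]].
have defBV : black_vertices N
    = [set [set d : N | black d & lab d == j] | j in L].
  rewrite -imset_comp; apply: eq_in_imset => d; rewrite inE => bd /=.
  apply/setP=> e; rewrite inE; apply/porbitP/andP => [[m ->]|[be /eqP lde]].
    by rewrite permX; have [-> _ ->] := black_iter m bd.
  apply/porbitP; rewrite -/(vertex_of d) -(lab_vertex_inj be bd lde).
  exact: porbit_id.
have : i \in L.
  suff -> : L = setT by [].
  apply/eqP; rewrite eqEcard subsetT cardsT card_ord -{1}(neb_size N) defBV.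
  exact: leq_imset_card.
by case/imsetP=> d; rewrite inE => bd ->; exists d; rewrite bd eqxx.
Qed.

Lemma black_dart_exists t i : exists d, [&& black d, ty d == t & lab d == i].
Proof.
have [d /andP[bd /eqP <-]] := lab_onto i.
have [m <-] := iter_ordS_onto (ty d) t.
by exists (iter m (cw N) d); have [-> -> ->] := black_iter m bd; rewrite !eqxx.
Qed.

Lemma corner_exists t i : exists d, [&& ~~ black d, ty d == t & lab d == i].
Proof.
have [d /and3P[bd /eqP td /eqP ld]] := black_dart_exists t i.
have [budd|edged] := boolP (is_bud d); last first.
  by exists (opp N d); rewrite edge_bipartite // bd ty_edge lab_edge td ld !eqxx.
pose L := [set lab b | b in black_buds N t].
have: i \in [set lab b | b in white_buds N t].
  suff ->: [set lab b | b in white_buds N t] = L.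
    by apply/imsetP; exists d; rewrite // inE budd bd td eqxx.
  apply/eqP; rewrite eqEcard; apply/andP; split.
    by apply/subsetP => _ /imsetP[b wb ->]; apply: lab_bud.
  rewrite (card_in_imset (@lab_bud_inj _ _ _ N t)) /white_buds -balanced.
  exact: leq_imset_card.
case/imsetP=> e; rewrite inE => /and3P[_ we te] ->.
by exists e; rewrite we te eqxx.
Qed.

Lemma white_dart_uniq d e :
  ~~ black d -> ~~ black e -> ty d = ty e -> lab d = lab e -> d = e.
Proof.
have no_mix (a b : N) : ~~ black a -> ~~ black b -> ty a = ty b -> lab a = lab b ->
    is_bud a -> is_bud b.
  move=> wa wb tab lab_ab buda; apply: contraT => edgeb.
  have /imsetP[c] : lab a \in [set lab b | b in black_buds N (ty a)].
    by apply: lab_bud; rewrite inE buda wa eqxx.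
  rewrite inE => /and3P[budc bc /eqP tc] lc.
  have cE : c = opp N b.
    apply: black_dart_uniq; rewrite ?edge_bipartite // ?ty_edge ?lab_edge.
      by rewrite tc tab.
    by rewrite -lc.
  by move: budc edgeb; rewrite /is_bud cE oppK eq_sym => ->.
move=> wd we tde lde; have [budd|edged] := boolP (is_bud d).
  have bude := no_mix _ _ wd we tde lde budd.
  by apply: (@lab_bud_inj _ _ _ N (ty d)); rewrite ?inE ?budd ?bude ?wd ?we ?tde /=.
have edgee : ~~ is_bud e by apply: contra edged; apply: no_mix.
apply: (@perm_inj _ (opp N)); apply: black_dart_uniq.
- by rewrite edge_bipartite.
- by rewrite edge_bipartite.
- by rewrite !ty_edge.
- by rewrite !lab_edge.
Qed.

(* The unique edge or white bud of type x.1 and label x.2, seen from its incident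
   white vertex; also the corner c(x) that precedes it. *)
Definition corner (x : 'I_k * 'I_n) : N := xchoose (corner_exists x.1 x.2).

Lemma cornerP x :
  [/\ ~~ black (corner x), ty (corner x) = x.1 & lab (corner x) = x.2].
Proof.
rewrite /corner; have /and3P[] := xchooseP (corner_exists x.1 x.2).
by move=> wc /eqP tc /eqP lc; split.
Qed.

Lemma corner_inj : injective corner.
Proof.
move=> [t i] [t' i'] eq_c; have [_ /= tx lx] := cornerP (t, i).
have [_ /= ty' ly] := cornerP (t', i'); congr (_, _).
  by rewrite -tx eq_c.
by rewrite -lx eq_c.
Qed.

Lemma corner_onto d : ~~ black d -> corner (ty d, lab d) = d.
Proof. by move=> wd; have [wc tc lc] := cornerP (ty d, lab d); apply: white_dart_uniq. Qed.

Lemma root_dart_exists : exists d, (d \in root N) && black d.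
Proof.
have /imsetP[d] := root_black N; rewrite inE => bd ->.
by exists d; rewrite bd porbit_id.
Qed.

Definition root_label : 'I_n := lab (xchoose root_dart_exists).

Lemma root_labelP d : d \in root N -> lab d = root_label.
Proof.
rewrite /root_label; have /andP[] := xchooseP root_dart_exists.
set e := xchoose _; have /imsetP[r] := root_black N; rewrite inE => br -> .
by move=> /porbitP[a ->] _ /porbitP[b ->]; rewrite !permX; have [_ _ ->] := black_iter a br;
   have [_ _ ->] := black_iter b br.
Qed.

Fact type_gt0 : 0 < k.
Proof. by have [d _] := root_dart_exists; case: (ty d) => m; apply: leq_trans. Qed.

Definition root_index : 'I_k * 'I_n := (ord_last type_gt0, root_label).

(* The number of steps needed to reach c(x) when turning around N, starting just
   after c(k, l0); hence c(k, l0) itself is reached last. *)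
Definition rank (x : 'I_k * 'I_n) : nat :=
  findex (face_perm N) (face_perm N (corner root_index)) (corner x).

Definition appears_before (x y : 'I_k * 'I_n) : bool := rank x < rank y.

Lemma face_connect d e : fconnect (face_perm N) d e.
Proof.
have /eqP/cards1P[F defF] := one_face N.
have: porbit (face_perm N) d \in faces N by apply: imset_f.
have: porbit (face_perm N) e \in faces N by apply: imset_f.
rewrite defF !inE => /eqP <- /eqP de.
have: e \in porbit (face_perm N) d by rewrite de porbit_id.
by case/porbitP=> m ->; rewrite permX fconnect_iter.
Qed.

Lemma rank_inj : injective rank.
Proof.
move=> x y eq_r; apply: corner_inj.
rewrite -(iter_findex (face_connect (face_perm N (corner root_index)) (corner x))).
by rewrite -/(rank x) eq_r iter_findex // face_connect.
Qed.

Lemma root_index_max x : x != root_index -> appears_before x root_index.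
Proof.
move=> ne_x; rewrite /appears_before ltn_neqAle (inj_eq rank_inj) ne_x /=.
set f : N -> N := face_perm N; set c := corner root_index.
have f_inj : injective f by apply: perm_inj.
have ordE : fingraph.order f (f c) = fingraph.order f c.
  by apply: eq_card => d; rewrite !inE -(same_fconnect1 f_inj c).
have cE : rank root_index = (fingraph.order f c).-1.
  rewrite /rank -/f -/c -{2}(finv_f f_inj c) /finv ordE findex_iter //.
  by rewrite ordE prednK // order_gt0.
rewrite cE -ltnS prednK ?order_gt0 // -ordE findex_max //; exact: face_connect.
Qed.

Lemma omega_exists (t : 'I_k) :
  exists w : 'S_n,
    [forall i : 'I_n, forall j : 'I_n, (i < j) ==> appears_before (t, w i) (t, w j)].
Proof.
pose le (i j : 'I_n) := rank (t, i) <= rank (t, j).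
pose s := sort le (enum 'I_n).
have le_total : total le by move=> i j; apply: leq_total.
have le_trans : transitive le by move=> j i l; apply: leq_trans.
have size_s : size s = n by rewrite size_sort size_enum_ord.
have uniq_s : uniq s by rewrite sort_uniq enum_uniq.
have g_inj : injective (fun i : 'I_n => nth i s i).
  move=> i j /eqP; rewrite (set_nth_default i j) ?size_s // nth_uniq ?size_s //.
  by move=> /eqP/val_inj.
exists (perm g_inj); apply/forallP=> i; apply/forallP=> j; apply/implyP=> lt_ij.
rewrite /appears_before ltn_neqAle (inj_eq rank_inj) xpair_eqE eqxx /=.
rewrite (inj_eq perm_inj) neq_ltn lt_ij /= !permE.
rewrite (set_nth_default i j) ?size_s //.
have := sorted_ltn_nth le_trans i (sort_sorted le_total (enum 'I_n)).
by apply; rewrite ?inE ?size_s.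
Qed.

Definition omega (t : 'I_k) : 'S_n := xchoose (omega_exists t).

Lemma omegaP t (i j : 'I_n) :
  i < j -> appears_before (t, omega t i) (t, omega t j).
Proof.
by move=> lt_ij; have /forallP/(_ i)/forallP/(_ j)/implyP := xchooseP (omega_exists t); apply.
Qed.

Definition bud_types (i : 'I_n) : {set 'I_k} :=
  [set ty d | d in [set d : N | [&& is_bud d, black d & lab d == i]]].

Definition Psi : prebidding k n :=
  ([ffun t => omega t], [ffun i => bud_types i]).

End Corners.

Definition is_bidding (k n : nat) (p : 'I_k -> nat) (B : prebidding k n) : Prop :=
  (forall i, B.2 i \proper [set: 'I_k])
  /\ (forall t, #|[set i | t \in B.2 i]| = p t).

(* For t \notin R, the search finds the least r with t + r + 1 \notin R; there is
   one since r = k - 1 qualifies. *)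
Definition alpha (k : nat) (t : 'I_k) (R : {set 'I_k}) : 'I_k :=
  if t \in R then ord_pred t
  else iter (find (fun r => iter r.+1 (@ordS k) t \notin R) (iota 0 k)) (@ordS k) t.

Lemma alphaP (k : nat) (t : 'I_k) (R : {set 'I_k}) : t \notin R ->
  exists r, [/\ alpha t R = iter r (@ordS k) t,
                forall s, 0 < s <= r -> iter s (@ordS k) t \in R
              & iter r.+1 (@ordS k) t \notin R].
Proof.
move=> tR; rewrite /alpha (negPf tR); set P : pred nat := (P in find P _).
have k_gt0 : 0 < k by case: (t) => m; apply: leq_trans.
have hasP : has P (iota 0 k).
  apply/hasP; exists k.-1; first by rewrite mem_iota /= add0n ltn_predL.
  rewrite /P prednK //; suff -> : iter k (@ordS k) t = t by [].
  by apply: val_inj; rewrite /= iter_ordS modnDr modn_small.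
have lt_r : find P (iota 0 k) < k by rewrite -{2}(size_iota 0 k) -has_find.
exists (find P (iota 0 k)); split=> //.
  case=> // s /= lt_s.
  have := before_find 0 lt_s; rewrite nth_iota ?add0n; last exact: ltn_trans lt_s _.
  by move/negbFE.
by have := nth_find 0 hasP; rewrite nth_iota // add0n.
Qed.

(* Undirected multigraphs, loops allowed.  An arc (e, b) is the edge e with a
   direction of traversal. *)
Section Multigraph.
Variables (V E : finType) (ends : E -> V * V).

Definition arc_src (a : E * bool) : V := if a.2 then (ends a.1).1 else (ends a.1).2.
Definition arc_dst (a : E * bool) : V := if a.2 then (ends a.1).2 else (ends a.1).1.

Definition mg_connected : Prop :=
  forall x y, connect (fun u v => [exists a, (arc_src a == u) && (arc_dst a == v)]) x y.

(* Cycles have no repeated edge and no repeated vertex; a loop is a cycle of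
   length 1 and two parallel edges form a cycle of length 2. *)
Definition mg_cycle (c : seq (E * bool)) : bool :=
  [&& c != [::], path.cycle (fun a b => arc_dst a == arc_src b) c,
      uniq (map fst c) & uniq (map arc_src c)].

Definition mg_tree : Prop := mg_connected /\ forall c, ~~ mg_cycle c.

End Multigraph.

(* The edges are indexed by the ordinals of 'I_k other than the last one, i.e. by
   t = 1, .., k - 1. *)
Definition bidding_edge (k n : nat) (n_gt0 : 0 < n) (B : prebidding k n)
    (t : {t : 'I_k | t.+1 < k}) : 'I_k * 'I_k :=
  (val t, alpha (val t) (B.2 (B.1 (val t) (ord_last n_gt0)))).

Definition valid_bidding (k n : nat) (n_gt0 : 0 < n) (p : 'I_k -> nat)
    (B : prebidding k n) : Prop :=
  is_bidding p B /\ mg_tree (bidding_edge n_gt0 B).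

(* Main.v *)
(* The next white corner of the face after c(t, i) has type alpha(t, R_i), so the
   unique face of a nebula is an Eulerian tour of the digraph on [k] with arcs
   (t, i) : t -> alpha(t, R_i), which is balanced since alpha(-, R) is injective.
   The permutation omega_t is the order in which the tour leaves t and, as in the
   BEST theorem, the orders given by the tours ending with an arc out of k are
   those whose last exits form a tree rooted at k.  Conversely, the tour and the
   R_i determine the rotation around the white vertices. *)
Require Import Defs.
From mathcomp Require Import all_boot all_fingroup.

Set Implicit Arguments.
Unset Strict Implicit.
Unset Printing Implicit Defensive.

(** * The map alpha and the walk around a black vertex *)

(** Fixing the exit orders makes the tour deterministic: each visit to t leaves through the first
    label of the order at t not yet used. This greedy walk serves both directions. Two tours with
    the same exit orders go through the same states; and on a valid bidding the walk cannot stop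
    early, because exhaustion of k, once the walk is back at its start, spreads down the tree of
    last exits to every type. The face also visits black corners, so ranks along it have gaps; this
    is why [eulerian_order] only compares ranks and never counts steps. Colour, type and label are
    coordinates for the half-edges. In them the sets R_i fix everything except the rotation at white
    vertices, which is the tour composed with the inverse of (t, i) -> (alpha(t, R_i), i). This
    composition is what is read off for injectivity and what is taken as a definition for
    surjectivity. *)

Section Alpha.
Variable k : nat.
Implicit Types (t : 'I_k) (R : {set 'I_k}).

Lemma iter_ordS_inj m : injective (iter m (@ordS k)).
Proof. by elim: m => [|m IHm] x y //= /(@ordS_inj k)/IHm. Qed.

(** The successor of [alpha t R] lies in R exactly when t does. If it does, it is t itself;
    otherwise t is the first type outside R met when going backwards from [alpha t R], that value
    included. *)
Lemma alpha_inj R : injective (fun t => alpha t R).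
Proof.
have out_in s t : s \in R -> t \notin R -> alpha s R = alpha t R -> False.
  move=> sR tR; have [r [-> _ /negP]] := alphaP tR.
  by rewrite /alpha sR iterS => + eq_st; rewrite -eq_st ord_predK.
have out_out s t r r' : t \notin R -> (forall q, 0 < q <= r -> iter q (@ordS k) s \in R) ->
    iter r (@ordS k) s = iter r' (@ordS k) t -> r <= r'.
  move=> tR inR eq_st; rewrite leqNgt; apply/negP=> lt_rr'; case/negP: tR.
  have -> : t = iter (r - r') (@ordS k) s.
    by apply: (@iter_ordS_inj r'); rewrite -eq_st -iterD subnKC // ltnW.
  by apply: inR; rewrite subn_gt0 lt_rr' leq_subr.
move=> s t /= eq_st; have [sR|sR] := boolP (s \in R); have [tR|tR] := boolP (t \in R).
- by move: eq_st; rewrite /alpha sR tR => /(can_inj (@ord_predK k)).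
- by case: (out_in s t).
- by case: (out_in t s).
have [r [sE sI _]] := alphaP sR; have [r' [tE tI _]] := alphaP tR.
move: eq_st; rewrite sE tE => eq_st; move: (eq_st).
have /eqP-> : r == r'.
  by rewrite eqn_leq (out_out s t r r') // (out_out t s r' r).
exact: iter_ordS_inj.
Qed.

Lemma alpha_onto R t : exists s, alpha s R = t.
Proof.
by have [g _ gK] := injF_bij (@alpha_inj R); exists (g t); apply: gK.
Qed.

End Alpha.

Section FaceWalk.
Variables (k n : nat) (D : finType) (cw opp : D -> D) (black : pred D).
Variables (ty : D -> 'I_k) (lab : D -> 'I_n) (R : 'I_n -> {set 'I_k}).
Hypothesis black_cw : forall d, black (cw d) = black d.
Hypothesis ty_opp : forall d, ty (opp d) = ty d.
Hypothesis lab_opp : forall d, lab (opp d) = lab d.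
Hypothesis black_opp : forall d, opp d != d -> black (opp d) = ~~ black d.
Hypothesis black_rot : forall d, black d -> ty (cw d) = ordS (ty d).
Hypothesis lab_cw : forall d, black d -> lab (cw d) = lab d.
Hypothesis bud_R : forall d, (opp d == d) = (ty d \in R (lab d)).

Let face d := cw (opp d).

(** A bud is just crossed, and [w] is [d]. Otherwise the walk goes to the black end, crosses the
    buds that follow there, and returns to a white vertex through [w]; the rotation lowers the type
    by one there, whence the [ordS]. The section is about bare functions because it applies to a
    nebula and also to half-edges not yet known to form one. *)
Lemma face_next_white d : ~~ black d -> exists m w,
  [/\ iter m.+1 face d = cw w, ~~ black w, lab w = lab d,
      ty w = ordS (alpha (ty d) (R (lab d)))
    & forall s, s < m -> black (iter s.+1 face d)].
Proof.
move=> wd; have [tR|tR] := boolP (ty d \in R (lab d)).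
  exists 0, d; split=> //=; last by rewrite /alpha tR ord_predK.
  by rewrite /face; move: tR; rewrite -bud_R => /eqP ->.
have [r [-> inR outR]] := alphaP tR.
have black_iter_face s : s <= r -> [/\ black (iter s.+1 face d),
    ty (iter s.+1 face d) = iter s.+1 (@ordS k) (ty d)
  & lab (iter s.+1 face d) = lab d].
  elim: s => [_|s IHs lt_sr]; first rewrite /= /face.
    have bd : black (opp d) by rewrite black_opp ?bud_R.
    by rewrite black_cw black_rot ?lab_cw ?lab_opp ?ty_opp.
  have [bs ts ls] := IHs (ltnW lt_sr); rewrite iterS; set e := iter s.+1 face d in bs ts ls *.
  have -> : face e = cw e.
    by rewrite /face (eqP (_ : opp e == e)) // bud_R ts ls inR.
  by split; [rewrite black_cw | rewrite black_rot // ts | rewrite lab_cw // ls].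
have [br tr lr] := black_iter_face r (leqnn r); pose e := iter r.+1 face d.
exists r.+1, (opp e); split=> //.
- by rewrite black_opp ?bud_R ?tr ?lr ?br.
- by rewrite lab_opp.
- by rewrite ty_opp tr.
by move=> s le_sr; have [] := black_iter_face s le_sr.
Qed.

(** At a black vertex the walk crosses buds until the first edge; [m] bounds the wait, as the type
    [m] steps ahead is not that of a bud. *)
Lemma face_reaches_white m d : iter m (@ordS k) (ty d) \notin R (lab d) ->
  exists s, ~~ black (iter s face d).
Proof.
elim: m d => [|m IHm] d tR; have [bd|wd] := boolP (black d); try by exists 0.
  by exists 1; rewrite /= /face black_cw black_opp ?bud_R // bd.
have [bud|edge] := eqVneq (opp d) d; last first.
  by exists 1; rewrite /= /face black_cw black_opp // bd.
have [|s ws] := IHm (face d); last by exists s.+1; rewrite iterSr.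
by rewrite /face bud black_rot // lab_cw // -iterSr.
Qed.

End FaceWalk.

(** * The BEST theorem, with the order of exits at each vertex *)

Section Position.
Variables (T : finType) (rk : T -> nat).

(** The rank with its gaps removed, so that orders measured on different scales can be compared. *)
Definition pos (x : T) : nat := #|[set y | rk y < rk x]|.

Lemma pos_mono x y : (pos x < pos y) = (rk x < rk y).
Proof.
have le_pos a b : rk a <= rk b -> pos a <= pos b.
  by move=> le_ab; apply/subset_leq_card/subsetP=> c; rewrite !inE => /leq_trans->.
have [lt_xy|/le_pos] := ltnP (rk x) (rk y); last by rewrite ltnNge => ->.
apply: proper_card; apply/properP; split.
  by apply/subsetP=> c; rewrite !inE => /ltn_trans->.
by exists x; rewrite !inE ?ltnn.
Qed.

Lemma pos_lt x : pos x < #|T|.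
Proof.
rewrite -cardsT; apply: proper_card; apply/properP; split; first exact: subsetT.
by exists x; rewrite !inE ?ltnn.
Qed.

Hypothesis rk_inj : injective rk.

Lemma pos_inj : injective pos.
Proof.
move=> x y eq_p; apply: rk_inj.
by have [] := ltngtP (rk x) (rk y); rewrite // -pos_mono eq_p ltnn.
Qed.

Lemma pos_onto m : m < #|T| -> exists x, pos x = m.
Proof.
move=> lt_m; pose f x : 'I_#|T| := Ordinal (pos_lt x).
have f_inj : injective f by move=> x y /(congr1 val)/pos_inj.
have [g _ gK] : bijective f by apply: inj_card_bij; rewrite ?card_ord.
by exists (g (Ordinal lt_m)); have /(congr1 val) := gK (Ordinal lt_m).
Qed.

End Position.

(** A permutation that sorts the keys sends i to the label with exactly i smaller keys. *)
Lemma sorting_perm_uniq n (key : 'I_n -> nat) (w w' : 'S_n) : injective key ->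
    (forall i j : 'I_n, i < j -> key (w i) < key (w j)) ->
    (forall i j : 'I_n, i < j -> key (w' i) < key (w' j)) ->
  w = w'.
Proof.
have pos_w (v : 'S_n) : (forall i j : 'I_n, i < j -> key (v i) < key (v j)) ->
    forall i, pos key (v i) = i.
  move=> v_mono i; rewrite /pos -(card_imset _ (@perm_inj _ v^-1)).
  have wid_inj : injective (widen_ord (ltnW (ltn_ord i))).
    by move=> a b /(congr1 val) /= /val_inj.
  rewrite -[RHS](card_ord i) -cardsT -(card_imset _ wid_inj).
  congr #|pred_of_set _|; apply/setP=> j.
  have -> : j \in [set v^-1%g x | x in [set y | key y < key (v i)]] = (j < i).
    rewrite -{1}(permK v j) mem_imset ?inE //; last exact: perm_inj.
    have [/v_mono ->//|lt_ij|/val_inj->] := ltngtP j i; last exact: ltnn.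
    by apply/negbTE; rewrite -leqNgt ltnW // v_mono.
  apply/idP/imsetP => [lt_ji|[m _ ->]]; last exact: (ltn_ord m).
  by exists (Ordinal lt_ji); [rewrite inE | apply: val_inj].
move=> key_inj wm w'm; apply/permP=> i; apply: (pos_inj key_inj).
by rewrite !pos_w.
Qed.

Section Tour.
Variables (V : finType) (n : nat) (n_gt0 : 0 < n).
Variables (w : V -> 'S_n) (tau : V * 'I_n -> V) (r : V).
Local Notation arc := (V * 'I_n)%type.

Definition last_arc (t : V) : arc := (t, w t (ord_last n_gt0)).

(* [rk] is the order of appearance along an Eulerian tour [phi] whose last arc is
   [last_arc r]; [phi] sends an arc to the next one, whose source is the target
   [tau] of the former. *)
Definition eulerian_order (phi : arc -> arc) (rk : arc -> nat) : Prop :=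
  [/\ injective rk,
      forall x, (phi x).1 = tau x,
      forall x, x != last_arc r ->
        rk x < rk (phi x) /\ forall y, rk y < rk (phi x) -> rk y <= rk x,
      forall y, rk (phi (last_arc r)) <= rk y
    & forall t (i j : 'I_n), i < j -> rk (t, w t i) < rk (t, w t j)].

(** The default is returned only beyond the n-th exit from a vertex, which [live] excludes. *)
Definition nth_label (m : nat) : 'I_n := insubd (ord_last n_gt0) m.

(* A state is the current vertex, with the number of previous visits to each
   vertex; the j-th visit to t leaves through the arc (t, w t j). *)
Definition exit_arc (s : V * {ffun V -> nat}) : arc := (s.1, w s.1 (nth_label (s.2 s.1))).

Definition tour_step (s : V * {ffun V -> nat}) : V * {ffun V -> nat} :=
  (tau (exit_arc s), [ffun t => s.2 t + (t == s.1)]).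

Definition tour_state (m : nat) : V * {ffun V -> nat} :=
  iter m tour_step (tau (last_arc r), [ffun=> 0]).

Lemma nth_labelE (i : 'I_n) : nth_label i = i.
Proof. by rewrite /nth_label valKd. Qed.

(** * A tour is determined by its exit orders *)

Section Uniqueness.
Variables (phi : arc -> arc) (rk : arc -> nat).
Hypothesis phi_rk : eulerian_order phi rk.

Let rk_inj : injective rk. Proof. by case: phi_rk. Qed.
Let src_phi x : (phi x).1 = tau x. Proof. by case: phi_rk. Qed.
Let rk_phi x : x != last_arc r -> rk x < rk (phi x). Proof. by case: phi_rk => _ _ H _ _ /H[]. Qed.
Let rk_phi_next x y : x != last_arc r -> (rk y < rk (phi x)) = (rk y <= rk x).
Proof.
case: phi_rk => _ _ H _ _ /H[lt_x next]; apply/idP/idP; first exact: next.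
by move/leq_ltn_trans; apply.
Qed.
Let rk_first y : rk (phi (last_arc r)) <= rk y. Proof. by case: phi_rk. Qed.
Let rk_w t (i j : 'I_n) : (rk (t, w t i) < rk (t, w t j)) = (i < j).
Proof.
case: phi_rk => _ _ _ _ w_mono.
have [/w_mono->//|/w_mono lt|/val_inj->] := ltngtP i j; last exact: ltnn.
by apply/negbTE; rewrite -leqNgt ltnW.
Qed.

(** [phi x] is the immediate successor of [x] in rank, except for the last arc of r, sent to the
    minimum, which succeeds nothing. *)
Lemma eulerian_inj : injective phi.
Proof.
have root_out x : x != last_arc r -> phi x = phi (last_arc r) -> False.
  by move=> /rk_phi + eq_phi; rewrite eq_phi ltnNge rk_first.
move=> x y eq_phi; have [xr|xr] := eqVneq x (last_arc r); have [yr|yr] := eqVneq y (last_arc r).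
- by rewrite xr yr.
- by case: (root_out y yr); rewrite -eq_phi xr.
- by case: (root_out x xr); rewrite eq_phi yr.
apply: rk_inj; apply/eqP; rewrite eqn_leq -(rk_phi_next x yr) -(rk_phi_next y xr).
by rewrite -eq_phi rk_phi // eq_phi rk_phi.
Qed.

Lemma card_label_before t (j : 'I_n) (P : pred arc) :
    (forall i, P (t, w t i) = (i < j)) ->
  #|[set y : arc | (y.1 == t) && P y]| = j.
Proof.
move=> Pw; pose f (i : 'I_j) : arc := (t, w t (widen_ord (ltnW (ltn_ord j)) i)).
have f_inj : injective f by move=> a b [/perm_inj/(congr1 val)] /= /val_inj.
rewrite -[RHS](card_ord j) -cardsT -(card_imset _ f_inj); apply: eq_card => -[u l].
rewrite !inE /=; apply/andP/imsetP => [[/eqP->]|[i _ [-> ->]]]; last first.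
  by rewrite eqxx Pw /=.
rewrite -[l](permKV (w t)) Pw => lt_l; exists (Ordinal lt_l) => //.
by congr (_, w t _); apply: val_inj.
Qed.

Lemma eulerian_ind (P : arc -> Prop) :
    P (phi (last_arc r)) -> (forall x, x != last_arc r -> P x -> P (phi x)) ->
  forall x, P x.
Proof.
move=> P0 PS; have [psi _ psiK] := injF_bij eulerian_inj.
move=> x; move: {2}(rk x) (leqnn (rk x)) => m; elim: m x => [|m IHm] x le_x.
  have -> // : x = phi (last_arc r).
  by apply: rk_inj; apply/eqP; rewrite eqn_leq rk_first (leq_trans le_x).
have [xr|xr] := eqVneq (psi x) (last_arc r); first by rewrite -(psiK x) xr.
rewrite -(psiK x); apply: PS => //; apply: IHm; rewrite -ltnS (leq_trans _ le_x) //.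
by rewrite -{2}(psiK x) rk_phi.
Qed.

Lemma pos_first : pos rk (phi (last_arc r)) = 0.
Proof. by apply/eqP; rewrite cards_eq0; apply/eqP/setP=> y; rewrite !inE ltnNge rk_first. Qed.

Lemma pos_phi x : x != last_arc r -> pos rk (phi x) = (pos rk x).+1.
Proof.
move=> xr; rewrite /pos [RHS](_ : _ = #|x |: [set y | rk y < rk x]|); last first.
  by rewrite cardsU1 inE ltnn.
apply: eq_card => y; rewrite !inE rk_phi_next // leq_eqVlt.
by rewrite (inj_eq rk_inj).
Qed.

Lemma exit_arc_state x :
    let c := [ffun t => #|[set y : arc | (y.1 == t) && (rk y < rk x)]|] in
  exit_arc (x.1, c) = x.
Proof.
case: x => t l /=; rewrite /exit_arc /= ffunE -{2}[l](permKV (w t)).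
rewrite (@card_label_before t ((w t)^-1%g l)) ?nth_labelE ?permKV //.
by move=> i; rewrite -{1}[l](permKV (w t)) rk_w.
Qed.

(** When [x] is taken, the earlier visits to t are the arcs out of t ranked before [x]. The left
    side depends on the exit orders alone, hence so does the arc at each position. *)
Lemma tour_state_pos x : tour_state (pos rk x)
  = (x.1, [ffun t => #|[set y : arc | (y.1 == t) && (rk y < rk x)]|]).
Proof.
elim/eulerian_ind: x => [|x xr IHx].
  rewrite pos_first /= src_phi; congr (_, _); apply/ffunP=> t; rewrite !ffunE.
  by apply/esym/eqP; rewrite cards_eq0; apply/eqP/setP=> y; rewrite !inE ltnNge rk_first andbF.
rewrite pos_phi //= IHx /tour_step exit_arc_state src_phi; congr (_, _).
apply/ffunP=> t; rewrite !ffunE /=.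
rewrite (cardsD1 x [set y | _ & rk y < rk (phi x)]) inE rk_phi // andbT addnC eq_sym.
congr (_ + _); apply: eq_card => y; rewrite !inE rk_phi_next // [in RHS]leq_eqVlt.
rewrite (inj_eq rk_inj); case: (eqVneq y x) => [->|] //=; by rewrite ltnn andbF.
Qed.

Lemma exit_arc_pos x : exit_arc (tour_state (pos rk x)) = x.
Proof. by rewrite tour_state_pos exit_arc_state. Qed.

(** After its last exit from t the tour still has to leave the target of that arc, so the last exit
    there comes later. This is why last exits cannot form a cycle. *)
Lemma last_arc_climbs t : t != r ->
  rk (last_arc t) < rk (last_arc (tau (last_arc t))).
Proof.
move=> tr; have lr : last_arc t != last_arc r by apply: contra tr => /eqP[->].
apply: leq_trans (rk_phi lr) _; have := src_phi (last_arc t).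
case: (phi (last_arc t)) => u l /= ->; rewrite leqNgt -[l](permKV (w (tau (last_arc t)))) rk_w.
by rewrite -leqNgt -ltnS prednK.
Qed.

End Uniqueness.

Lemma eulerian_uniq phi phi' rk rk' :
  eulerian_order phi rk -> eulerian_order phi' rk' -> phi =1 phi'.
Proof.
move=> Er Er'; have rk_inj : injective rk by case: Er.
have rk'_inj : injective rk' by case: Er'.
have eq_pos x : pos rk x = pos rk' x.
  have [y py] := pos_onto rk'_inj (pos_lt rk x).
  suff xy : x = y by rewrite -py xy.
  by rewrite -(exit_arc_pos Er x) -py (exit_arc_pos Er').
move=> x; apply: (pos_inj rk_inj); rewrite [RHS]eq_pos.
have [->|xr] := eqVneq x (last_arc r); first by rewrite (pos_first Er) (pos_first Er').
by rewrite (pos_phi Er) // (pos_phi Er') // eq_pos.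
Qed.

(** * The greedy walk uses every arc *)

Section Existence.
Hypothesis indegree : forall v, #|[set e | tau e == v]| = n.
Hypothesis lead_to_root : forall t, fconnect (fun t => tau (last_arc t)) t r.

Local Notation t0 := (tau (last_arc r)).
Local Notation cur m := (tour_state m).1.
Local Notation visits m t := ((tour_state m).2 t).

Definition live (m : nat) : Prop := forall j, j < m -> visits j (cur j) < n.
Definition used (m : nat) : {set arc} := [set e | (w e.1)^-1%g e.2 < visits m e.1].

Lemma visitsS m t : visits m.+1 t = visits m t + (t == cur m).
Proof. by rewrite /= ffunE. Qed.

Lemma liveW m : live m.+1 -> live m.
Proof. by move=> lm j /ltnW; apply: lm. Qed.

Lemma leq_visits m t : live m -> visits m t <= n.
Proof.
elim: m => [|m IHm] lm; first by rewrite ffunE.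
rewrite visitsS; have [->|_] := eqVneq t (cur m); first by rewrite addn1 lm.
by rewrite addn0 IHm //; apply: liveW.
Qed.

Lemma visits_mono m m' t : m <= m' -> visits m t <= visits m' t.
Proof.
move/subnK <-; elim: (m' - m) => // j IHj.
by rewrite addSn visitsS (leq_trans IHj) ?leq_addr.
Qed.

Lemma used_mono m m' : m <= m' -> used m \subset used m'.
Proof.
move=> le_m; apply/subsetP=> e; rewrite !inE => /leq_trans; apply.
exact: visits_mono.
Qed.

Lemma exit_arc_unused m : visits m (cur m) < n -> exit_arc (tour_state m) \notin used m.
Proof. by move=> lt_n; rewrite inE /= permK val_insubd lt_n ltnn. Qed.

Lemma usedS m : visits m (cur m) < n -> used m.+1 = exit_arc (tour_state m) |: used m.
Proof.
move=> lt_n; apply/setP=> -[t l]; rewrite !inE visitsS /exit_arc /= xpair_eqE.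
have [->|_] /= := eqVneq t (cur m); last by rewrite addn0.
rewrite addn1 ltnS leq_eqVlt; congr (_ || _).
rewrite -(inj_eq (@perm_inj _ (w (cur m))^-1)) permK -val_eqE /= val_insubd lt_n.
by [].
Qed.

Lemma card_used m : live m -> #|used m| = m.
Proof.
elim: m => [|m IHm] lm.
  by apply/eqP; rewrite cards_eq0; apply/eqP/setP=> e; rewrite !inE ffunE.
by rewrite usedS ?lm // cardsU1 exit_arc_unused ?lm // IHm //; apply: liveW.
Qed.

(** Entries into v against exits from v: the start is an entry without an arc, and the present
    position is an entry not yet followed by an exit. *)
Lemma balance m v : live m ->
  #|[set e in used m | tau e == v]| + (v == t0) = visits m v + (v == cur m).
Proof.
elim: m => [|m IHm] lm.
  rewrite ffunE (_ : [set e in _ | _] = set0) ?cards0 //.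
  by apply/setP=> e; rewrite !inE ffunE.
rewrite visitsS -(IHm (liveW lm)) usedS ?lm // addnAC; congr (_ + _).
have [<-|ne_v] := eqVneq (cur m.+1) v; rewrite ?[v == _]eq_sym.
  have := exit_arc_unused (lm m (leqnn _)); rewrite inE => /negbTE unused_m.
  rewrite addn1 (cardsD1 (exit_arc (tour_state m))) !inE !eqxx add1n.
  congr _.+1; apply: eq_card => e; rewrite !inE.
  by have [->|_] := eqVneq e (exit_arc _); rewrite ?unused_m.
rewrite addn0; apply: eq_card => e; rewrite !inE.
have [->|_] //= := eqVneq e (exit_arc _).
by move: (negbTE ne_v) => /= ->; rewrite andbF.
Qed.

Lemma used_last_arc m t : (last_arc t \in used m) = (n <= visits m t).
Proof. by rewrite inE /= permK /= prednK. Qed.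

Lemma saturated m v e : live m -> n <= #|[set e in used m | tau e == v]| ->
  tau e = v -> e \in used m.
Proof.
move=> lm le_n tau_e; have : [set e in used m | tau e == v] == [set e | tau e == v].
  by rewrite eqEcard indegree le_n andbT; apply/subsetP=> x; rewrite !inE => /andP[].
by move=> /eqP/setP/(_ e); rewrite !inE tau_e eqxx andbT.
Qed.

(* Once the tour is back at its start with all arcs out of r used, every vertex
   whose parent has all its outgoing arcs used has its last arc used. *)
Lemma closing m : live m -> cur m = t0 -> n <= visits m r -> used m = setT.
Proof.
move=> lm curm r_full.
have full t : n <= visits m t.
  have := iter_findex (lead_to_root t); move: (findex _ t r) => i.
  elim: i t => [|i IHi] t; [by move=> /= -> | rewrite iterSr => /IHi full_t].
  (* The walk being at its start, the corrections in [balance] cancel: a parent left n times was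
     entered n times, hence by all its incoming arcs, among them the last arc of t. *)
  rewrite -used_last_arc; apply: (saturated lm _ (erefl (tau (last_arc t)))).
  by move: (balance (tau (last_arc t)) lm); rewrite curm => /addIn ->.
apply/setP=> -[t l]; rewrite !inE /=; exact: leq_trans (ltn_ord _) (full t).
Qed.

(** Suppose all n exits at the current vertex are used. Away from the start, [balance] gives n + 1
    entries, more than the indegree. At the start, all n incoming arcs are used, including the last
    arc of r; so r is exhausted, and by [closing] no arc is left. *)
Lemma live_total : live #|{: arc}|.
Proof.
suff live_le m : m <= #|{: arc}| -> live m by apply: live_le.
elim: m => [|m IHm] lt_m // j; rewrite ltnS leq_eqVlt => /predU1P[->|]; last first.
  by apply: IHm; apply: ltnW.
have lm := IHm (ltnW lt_m); rewrite ltnNge; apply/negP=> stuck.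
have full v : #|[set e in used m | tau e == v]| <= n.
  by rewrite -[leqRHS](indegree v) subset_leq_card //; apply/subsetP=> x; rewrite !inE => /andP[].
have := balance (cur m) lm; rewrite eqxx addn1.
case: eqP => [cur0 | _]; last first.
  by rewrite addn0 => eq_n; move: (full (cur m)); rewrite eq_n ltnNge stuck.
rewrite addn1 => -[eq_n]; have r_full : n <= visits m r.
  by rewrite -used_last_arc; apply: (saturated (v := cur m)); rewrite ?eq_n.
by move: lt_m; rewrite -(card_used lm) (closing lm cur0 r_full) cardsT ltnn.
Qed.

Definition tour_arc (m : 'I_#|{: arc}|) : arc := exit_arc (tour_state m).

Lemma tour_arc_inj : injective tour_arc.
Proof.
have lt_neq (a b : 'I_#|{: arc}|) : a < b -> tour_arc a = tour_arc b -> False.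
  move=> lt_ab eq_ab; case/negP: (exit_arc_unused (live_total (ltn_ord b))).
  rewrite -[exit_arc _]eq_ab; apply: (subsetP (used_mono lt_ab)).
  by rewrite usedS ?setU11 // live_total.
move=> a b eq_ab; apply: val_inj; have [/lt_neq|/lt_neq|//] := ltngtP a b; first by case.
by case.
Qed.

Lemma tour_returns : cur #|{: arc}| = t0.
Proof.
have lm := live_total; have usedT : used #|{: arc}| = setT.
  by apply/eqP; rewrite eqEcard subsetT cardsT (card_used lm) leqnn.
have := balance t0 lm; rewrite usedT eqxx.
rewrite (_ : [set e in setT | _] = [set e | tau e == t0]); last by apply/setP=> e; rewrite !inE.
have /eqP-> : visits #|{: arc}| t0 == n.
  by rewrite eqn_leq leq_visits // -used_last_arc usedT inE.
by rewrite indegree => /addnI; case: eqP => // ->.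
Qed.

(** This arc leads back to the start and exhausts r, so [closing] applies right after it. *)
Lemma tour_arc_last m : tour_arc m = last_arc r -> m.+1 = #|{: arc}|.
Proof.
move=> eq_m; have lm : live m.+1.
  by move=> j lt_j; apply: live_total; apply: leq_trans (ltn_ord m).
rewrite -(card_used lm) (closing lm) ?cardsT //.
  by rewrite /= -[exit_arc _]/(tour_arc m) eq_m.
rewrite -used_last_arc -eq_m usedS ?setU11 //; exact: live_total.
Qed.

Lemma eulerian_order_exists : exists (phi : {perm arc}) rk, eulerian_order phi rk.
Proof.
have [idx arcK idxK] : bijective tour_arc.
  by apply: inj_card_bij; [exact: tour_arc_inj | rewrite card_ord].
(* [ordS] wraps around, so the last arc is followed by the first; [tour_returns] makes this step
   follow [tau] too. *)
pose nxt e := tour_arc (ordS (idx e)).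
have nxt_inj : injective nxt.
  by apply: inj_comp tour_arc_inj (inj_comp (@ordS_inj _) (can_inj idxK)).
have idx_inj := can_inj idxK; pose rk e : nat := idx e.
have rk_nxt x : x != last_arc r -> rk (nxt x) = (rk x).+1.
  move=> xr; rewrite /rk /nxt arcK /= modn_small //.
  have := ltn_ord (idx x); rewrite leq_eqVlt => /predU1P[eq_card|//].
  have [y eq_y] : exists y, tour_arc y = last_arc r by exists (idx (last_arc r)).
  by case/eqP: xr; rewrite -(idxK x) -eq_y; congr tour_arc; apply: val_inj;
     apply: succn_inj; rewrite (tour_arc_last eq_y).
exists (perm nxt_inj), rk; split.
- by move=> x y /val_inj/idx_inj.
- move=> x; rewrite permE; transitivity (cur (idx x).+1); last first.
    by rewrite /= -[exit_arc _]/(tour_arc (idx x)) idxK.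
  rewrite -[LHS]/(cur ((idx x).+1 %% #|{: arc}|)).
  have := ltn_ord (idx x); rewrite leq_eqVlt => /predU1P[->|lt_x].
    by rewrite modnn tour_returns.
  by rewrite modn_small.
- by move=> x xr; rewrite permE rk_nxt //; split=> // y; rewrite ltnS.
- move=> y; rewrite permE /rk /nxt arcK /= (tour_arc_last (idxK _)) modnn //.
move=> t i j lt_ij; rewrite ltnNge; apply/negP=> le_ji.
have visits_idx (l : 'I_n) : visits (idx (t, w t l)) t = l.
  have := idxK (t, w t l); rewrite /tour_arc /exit_arc => -[cur_t].
  have := live_total (ltn_ord (idx (t, w t l))); rewrite cur_t => lt_n /perm_inj.
  by move/(congr1 val); rewrite val_insubd lt_n.
by move: (visits_mono t le_ji); rewrite !visits_idx leqNgt lt_ij.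
Qed.

End Existence.

End Tour.

(** * Trees given by a parent map *)

Section ParentTree.
Variables (V E : finType) (base : E -> V) (par : V -> V) (r : V) (ends : E -> V * V).
Hypothesis endsE : forall e, ends e = (base e, par (base e)).
Hypothesis base_neq : forall e, base e != r.

(** Leading to r through parents propagates along an undirected path that starts at r. From a parent
    to a child this is one more parent step. *)
Lemma lead_of_connected : mg_connected ends -> forall t, fconnect par t r.
Proof.
move=> conn t; have /connectP[s pth ->] := conn r t.
have : fconnect par r r by [].
elim: s {1 2 4}r pth => //= v s IHs u /andP[/existsP[a /andP[/eqP srca /eqP dsta]] pth] ur.
apply: IHs pth _; move: srca dsta ur; rewrite /arc_src /arc_dst endsE.
case: a.2 => /= <- <- //; last by apply: connect_trans; apply: fconnect1.
(* From a child to its parent: the child is not r, so its parent path to r passes through the parent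
   first. *)
case/connectP=> -[/= _ rE|v' p /= /andP[/eqP-> pth] ->]; last by apply/connectP; exists p.
by have := base_neq a.1; rewrite rE eqxx.
Qed.

Variable h : V -> nat.
Hypothesis h_par : forall t, t != r -> h t < h (par t).
Hypothesis base_onto : forall t, t != r -> exists e, base e = t.
Hypothesis base_inj : injective base.

Lemma mg_tree_of_potential : mg_tree ends.
Proof.
split=> [x y|c].
  set adj := (X in connect X); have adj_sym : connect_sym adj.
    apply: sym_connect_sym => u v; apply/existsP/existsP=> -[[e b] /andP[sa da]];
    by exists (e, ~~ b); rewrite /arc_src /arc_dst /=; move: sa da;
       rewrite /arc_src /arc_dst /=; case: b => -> ->.
  suff to_r t : connect adj t r by apply: connect_trans (to_r x) _; rewrite adj_sym.
  have h_max u : h u <= \max_v h v by apply: leq_bigmax.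
  (* Induction on the gap between [h t] and the maximum of [h]: parents climb, and a vertex with no
     gap must be r. *)
  move: {2}(_ - h t) (leqnn (\max_v h v - h t)) => m; elim: m t => [|m IHm] t le_m.
    have [->//|/h_par lt_h] := eqVneq t r.
    by move: le_m; rewrite leqn0 subn_eq0 leqNgt (leq_trans lt_h).
  have [->//|tr] := eqVneq t r; have [e et] := base_onto tr.
  apply: connect_trans (_ : connect adj t (par t)) _.
    by apply: connect1; apply/existsP; exists (e, true); rewrite /arc_src /arc_dst endsE et !eqxx.
  apply: IHm; rewrite -ltnS (leq_trans _ le_m) // ltn_sub2l ?h_par //.
  exact: leq_trans (h_par tr) _.
(* Both edges of the cycle at a source of least potential leave it towards the
   parent, so they coincide. *)
apply/negP=> /and4P[c_neq0 cyc_c uniq_e _].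
have [a0 a0c] : exists a, a \in c.
  by case: c c_neq0 {cyc_c uniq_e} => // a c _; exists a; rewrite mem_head.
case: (arg_minnP (fun a => h (arc_src ends a)) a0c) => {a0 a0c} a ac a_min.
have /eqP dst_prev := prev_cycle cyc_c ac; have /eqP dst_a := next_cycle cyc_c ac.
have prev_c : prev c a \in c by rewrite mem_prev.
have next_c : next c a \in c by rewrite mem_next.
have := a_min _ prev_c; have := a_min _ next_c; rewrite -dst_a.
have := h_par (base_neq a.1); have := h_par (base_neq (prev c a).1).
move: dst_prev; rewrite /arc_src /arc_dst !endsE /=.
case: (boolP a.2) => a2; case: (boolP (prev c a).2) => p2 /= eq_base hp ha.
- by move=> _; rewrite leqNgt -eq_base hp.
- move=> _ _; have /base_inj eq_e := eq_base.
  (* No edge is repeated in the cycle, so the two arcs are one, although their directions differ. *)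
  have : prev c a = a.
    have nth_e x : x \in c -> nth a.1 [seq i.1 | i <- c] (index x c) = x.1.
      by move=> xc; rewrite (nth_map a) ?index_mem // nth_index.
    have eq_i : index (prev c a) c = index a c.
      apply/eqP; rewrite -(nth_uniq a.1 _ _ uniq_e) ?size_map ?index_mem //.
      by rewrite !nth_e // eq_e.
    by rewrite -(nth_index a prev_c) eq_i nth_index.
  by move=> eq_p; move: p2; rewrite eq_p a2.
- by rewrite leqNgt ha.
- by rewrite leqNgt ha.
Qed.

End ParentTree.

(** * The tour of a nebula *)

Definition arc_target (k n : nat) (B : prebidding k n) (x : 'I_k * 'I_n) : 'I_k :=
  alpha x.1 (B.2 x.2).

Section Code.
Variables (k n : nat) (p : 'I_k -> nat) (N : lrnebula n p).
Implicit Types (d e : N) (x y : 'I_k * 'I_n).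

Lemma dart_uniq d e : black d = black e -> ty d = ty e -> lab d = lab e -> d = e.
Proof.
case: (boolP (black d)) => [bd /esym be|wd /esym/negbT we]; first exact: black_dart_uniq.
exact: white_dart_uniq.
Qed.

(** Being a bud depends only on type and label, at white vertices too: a white bud bears the label
    of a black bud of its type, and a half-edge is determined by colour, type and label. *)
Lemma bud_typesE d : (opp N d == d) = (ty d \in bud_types N (lab d)).
Proof.
rewrite -[LHS]/(is_bud d); apply/idP/imsetP => [budd|[e]].
  have [bd|wd] := boolP (black d); first by exists d; rewrite // inE budd bd eqxx.
  have /imsetP[e] : lab d \in [set lab b | b in black_buds N (ty d)].
    by apply: lab_bud; rewrite inE budd wd eqxx.
  by rewrite inE => /and3P[bude be /eqP te] le; exists e; rewrite // inE bude be le eqxx.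
rewrite inE => /and3P[/eqP bude be /eqP le] te; apply: contraT => edged.
have [bd|wd] := boolP (black d).
  by move: edged; rewrite /is_bud (@dart_uniq d e) ?bd ?be ?bude ?eqxx.
have eE : opp N d = e by apply: dart_uniq; rewrite ?edge_bipartite ?ty_edge ?lab_edge ?be.
by move: edged; rewrite /is_bud -(perm_inj (etrans bude (esym eE))) bude eqxx.
Qed.

Definition bdart x : N := xchoose (black_dart_exists N x.1 x.2).

Definition dart_of (b : bool) x : N := if b then bdart x else corner N x.

Lemma dart_ofP b x :
  [/\ black (dart_of b x) = b, ty (dart_of b x) = x.1 & lab (dart_of b x) = x.2].
Proof.
case: b; last by have [/negbTE] := cornerP N x.
by rewrite /= /bdart; have /and3P[-> /eqP-> /eqP->] := xchooseP (black_dart_exists N x.1 x.2).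
Qed.

Lemma dart_ofK d : dart_of (black d) (ty d, lab d) = d.
Proof. by have [] := dart_ofP (black d) (ty d, lab d) => *; apply: dart_uniq. Qed.

(** The corner after the half-edge by which the walk re-enters a white vertex. A formula, rather
    than a search along the face, can be solved for [cw]. *)
Definition next_arc x : 'I_k * 'I_n :=
  let d := cw N (corner N (ordS (alpha x.1 (bud_types N x.2)), x.2)) in (ty d, lab d).

Lemma face_corner x : exists m,
  iter m.+1 (face_perm N) (corner N x) = corner N (next_arc x)
  /\ forall s, s < m -> black (iter s.+1 (face_perm N) (corner N x)).
Proof.
have [wx tx lx] := cornerP N x.
have [m [v [itE wv lv tv bs]]] := face_next_white (@black_vertex _ N) (@ty_edge _ N)
  (@lab_edge _ _ _ N) (@edge_bipartite _ N) (@black_rotation _ N) (@lab_vertex _ _ _ N)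
  bud_typesE wx.
have faceE s : iter s (face_perm N) (corner N x) = iter s (fun d => cw N (opp N d)) (corner N x).
  by apply: eq_iter => d; rewrite permM.
exists m; split=> [|s lt_s]; last by rewrite faceE bs.
rewrite faceE itE /next_arc.
have -> : corner N (ordS (alpha x.1 (bud_types N x.2)), x.2) = v.
  by rewrite -(corner_onto wv) tv lv tx lx.
by rewrite corner_onto // black_vertex.
Qed.

Lemma next_arc_src x : (next_arc x).1 = alpha x.1 (bud_types N x.2).
Proof.
have [wv tv _] := cornerP N (ordS (alpha x.1 (bud_types N x.2)), x.2).
by rewrite /next_arc /= white_rotation // tv ordSK.
Qed.

Variables (k_gt0 : 0 < k) (n_gt0 : 0 < n).

(** The root corner is last among all corners, hence among those of type k. *)
Lemma root_indexE : root_index N = last_arc n_gt0 (Psi N).1 (ord_last k_gt0).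
Proof.
rewrite /last_arc /= ffunE; have -> : ord_last k_gt0 = ord_last (type_gt0 N) by apply: val_inj.
congr (_, _); set t := ord_last _; rewrite -[LHS](permKV (omega N t)); congr (omega N t _).
set j := ((omega N t)^-1)%g _; apply: val_inj; apply/eqP.
rewrite /= eqn_leq -ltnS prednK // ltn_ord /=.
rewrite leqNgt; apply/negP=> lt_j; have := @omegaP _ _ _ N t _ _ (lt_j : j < ord_last n_gt0).
rewrite {1}/j permKV => lt1; have := lt1; rewrite /appears_before ltnNge ltnW //.
apply: root_index_max; apply/eqP=> eq_r; move: lt1; rewrite eq_r.
by rewrite /appears_before ltnn.
Qed.

Lemma eulerian_rank :
  eulerian_order n_gt0 (Psi N).1 (arc_target (Psi N)) (ord_last k_gt0) next_arc (rank N).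
Proof.
pose F : N -> N := face_perm N; pose c := corner N (root_index N).
have itK x : iter (rank N x) F (F c) = corner N x by apply: iter_findex; apply: face_connect.
have rank_lt x : rank N x < fingraph.order F (F c) by apply: findex_max; apply: face_connect.
have rankE m x : m < fingraph.order F (F c) -> iter m F (F c) = corner N x -> rank N x = m.
  by move=> lt_m; rewrite /rank -/F -/c => <-; apply: findex_iter.
(* A stretch of black corners following the corner of [x] contains no corner of [y]. *)
have skip x y m : (forall s, s < m -> black (iter s.+1 F (corner N x))) ->
    rank N x < rank N y -> rank N x + m < rank N y.
  move=> blk lt_xy; rewrite ltnNge; apply/negP=> le_y; have [/negP[]] := cornerP N y.
  have eq_y : rank N y = (rank N y - (rank N x).+1).+1 + rank N x by rewrite addSnnS subnK.
  rewrite -itK eq_y iterD itK; apply: blk.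
  by rewrite ltn_subLR ?addSn ?ltnS // ltnW.
split; rewrite -?root_indexE.
- exact: rank_inj.
- by move=> x; rewrite next_arc_src /arc_target /= ffunE.
- move=> x xr; have [m [itE blk]] := face_corner x.
  have lt_x : rank N x < rank N (root_index N) by apply: root_index_max.
  (* The walk does not pass its origin in between: by [skip] the black stretch ends before the root
     corner. *)
  have eq_r : rank N (next_arc x) = m.+1 + rank N x.
    apply: rankE; last by rewrite iterD itK.
    by apply: leq_ltn_trans (rank_lt (root_index N)); rewrite addSn addnC skip.
  rewrite eq_r addSn ltnS leq_addl; split=> // y; rewrite ltnS => le_y.
  by rewrite leqNgt; apply/negP=> /(skip x y m blk); rewrite ltnNge addnC le_y.
- move=> y; have [m [itE blk]] := face_corner (root_index N).
  (* Ranks are counted from the corner after the root corner, so m + 1 steps from the latter amount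
     to rank m, or less after a full turn. *)
  have le_m : rank N (next_arc (root_index N)) <= m.
    have [lt_m|le_o] := ltnP m (fingraph.order F (F c)); last first.
      exact: leq_trans (ltnW (rank_lt _)) le_o.
    by rewrite (rankE m) // -iterSr.
  rewrite leqNgt; apply/negP=> lt_y; have [/negP[]] := cornerP N y.
  by rewrite -itK -iterSr; apply: blk; apply: leq_trans lt_y le_m.
by move=> t i j lt_ij; rewrite !ffunE; apply: omegaP.
Qed.

(** If all half-edges of a black vertex were buds, the face would turn around it forever and miss
    the white corners. *)
Lemma bud_types_proper i : bud_types N i \proper [set: 'I_k].
Proof.
rewrite properEneq subsetT andbT; apply/eqP=> budT.
have stay m : let d := iter m (face_perm N) (dart_of true (ord_last k_gt0, i)) in
    black d /\ lab d = i.
  elim: m => [|m [bm lm]] /=; first by have [-> _ ->] := dart_ofP true (ord_last k_gt0, i).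
  set d := iter m _ _ in bm lm *; have /eqP bud : opp N d == d by rewrite bud_typesE lm budT inE.
  by rewrite permM bud black_vertex lab_vertex.
have [/negP wc _ _] := cornerP N (ord_last k_gt0, i); apply: wc.
have := stay (findex (face_perm N) (dart_of true (ord_last k_gt0, i))
  (corner N (ord_last k_gt0, i))).
by rewrite /= iter_findex ?face_connect // => -[].
Qed.

Lemma Psi_bidding : is_bidding p (Psi N).
Proof.
split=> [i|t]; first by rewrite ffunE bud_types_proper.
rewrite -(neb_type N t) -(card_in_imset (f := @lab _ _ _ N)).
  apply: eq_card => i; rewrite !inE ffunE; apply/imsetP/imsetP => -[d].
    by rewrite inE => /and3P[bud bd /eqP ld] td; exists d; rewrite ?inE ?bud ?bd ?td ?eqxx.
  by rewrite inE => /and3P[bud bd /eqP td] ld; exists d; rewrite ?inE ?bud ?bd ?ld ?eqxx.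
move=> d e; rewrite !inE => /and3P[_ bd /eqP td] /and3P[_ be /eqP te] ld.
by apply: black_dart_uniq; rewrite ?te.
Qed.

Lemma mem_root d : (d \in Defs.root N) = black d && (lab d == root_label N).
Proof.
apply/idP/andP => [rd|[bd /eqP ld]].
  rewrite (root_labelP rd) eqxx; split=> //; move: rd.
  have /imsetP[e + ->] := root_black N; rewrite inE => be /porbitP[m ->].
  by rewrite permX; have [] := black_iter m be.
have [e /andP[re be]] := root_dart_exists N.
move: (re) => /root_labelP; rewrite -ld => le; move: re.
have /imsetP[r _ ->] := root_black N => er.
have <- : vertex_of e = vertex_of r by apply/eqP; rewrite eq_porbit_mem.
by rewrite (lab_vertex_inj be bd le) porbit_id.
Qed.

End Code.

(** * Validity as a condition on last exits *)

Section Validity.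
Variables (k n : nat) (k_gt0 : 0 < k) (n_gt0 : 0 < n).

Lemma bidding_edge_base_neq (e : {t : 'I_k | t.+1 < k}) : val e != ord_last k_gt0.
Proof. by case: e => t /= lt_t; apply/eqP=> eq_t; move: lt_t; rewrite eq_t /= prednK ?ltnn. Qed.

Definition bidding_parent (B : prebidding k n) (t : 'I_k) : 'I_k :=
  arc_target B (last_arc n_gt0 B.1 t).

Lemma Psi_valid (p : 'I_k -> nat) (N : lrnebula n p) : valid_bidding n_gt0 p (Psi N).
Proof.
split; first exact: Psi_bidding.
apply: (@mg_tree_of_potential _ _ val (bidding_parent (Psi N)) (ord_last k_gt0) _ _
          bidding_edge_base_neq (fun t => rank N (last_arc n_gt0 (Psi N).1 t))) => //.
- by move=> t; apply: last_arc_climbs (eulerian_rank N k_gt0 n_gt0) _.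
- move=> t; rewrite -val_eqE /= => neq_t.
  suff lt_t : t.+1 < k by exists (exist _ t lt_t).
  by rewrite ltn_neqAle ltn_ord andbT; apply: contra neq_t => /eqP/(congr1 predn) /= <-.
exact: val_inj.
Qed.

Lemma valid_lead (p : 'I_k -> nat) (B : prebidding k n) : valid_bidding n_gt0 p B ->
  forall t, fconnect (bidding_parent B) t (ord_last k_gt0).
Proof. by case=> _ [conn _]; apply: lead_of_connected bidding_edge_base_neq conn. Qed.

End Validity.

(** * Invariance and injectivity up to isomorphism *)

Section Isomorphism.
Variables (k n : nat) (p : 'I_k -> nat).
Implicit Types N : lrnebula n p.

Lemma Psi_iso N N' : nebula_iso N N' -> Psi N = Psi N'.
Proof.
case=> f [[g fK gK] [f_cw f_opp] [f_black f_ty] f_lab f_root].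
have f_inj := can_inj fK.
have f_corner x : f (corner N x) = corner N' x.
  have [wx tx lx] := cornerP N x; have [wx' tx' lx'] := cornerP N' x.
  by apply: white_dart_uniq; rewrite ?f_black ?f_ty ?f_lab ?tx ?lx.
have f_bud d : is_bud (f d) = is_bud d by rewrite /is_bud -f_opp (inj_eq f_inj).
have f_rootl : root_label N' = root_label N.
  have [d /andP[rd _]] := root_dart_exists N; rewrite -(root_labelP rd) -f_lab.
  by rewrite (@root_labelP _ _ _ N' (f d)) // -f_root imset_f.
have f_index : root_index N' = root_index N.
  by congr (_, _); [apply: val_inj | apply: f_rootl].
have f_face m d : f (iter m (face_perm N) d) = iter m (face_perm N') (f d).
  by elim: m => //= m IHm; rewrite !permM f_cw f_opp IHm.
(* [findex] is a least step count, so carrying walks over by [f], in both directions, gives equal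
   ranks. *)
have min_findex (D : finType) (F : D -> D) (x y : D) m :
    fconnect F x y -> iter m F x = y -> findex F x y <= m.
  move=> xy <-; have [lt_m|le_o] := ltnP m (fingraph.order F x); first by rewrite findex_iter.
  by apply: leq_trans (ltnW (findex_max _)) le_o; rewrite fconnect_iter.
have f_rank x : rank N' x = rank N x.
  rewrite /rank f_index -!f_corner; set c := corner N _; set d := corner N _.
  have -> : face_perm N' (f c) = f (face_perm N c) by rewrite (f_face 1).
  apply/eqP; rewrite eqn_leq; apply/andP; split; apply: min_findex; rewrite ?face_connect //.
    by rewrite -f_face iter_findex ?face_connect.
  by apply: f_inj; rewrite f_face iter_findex ?face_connect.
congr (_, _); apply/ffunP=> t; rewrite !ffunE; last first.
  apply/setP=> u; apply/imsetP/imsetP=> -[d]; rewrite inE => /and3P[bud bd ld] ->.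
    by exists (f d); rewrite ?f_ty // inE f_bud f_black f_lab bud bd.
  by exists (g d); rewrite -1?f_ty ?gK // inE -f_bud -f_black -f_lab gK bud bd.
apply: (sorting_perm_uniq (key := fun i => rank N (t, i))) => [i j /rank_inj[]//|i j|i j lt_ij].
  exact: omegaP.
by rewrite -!f_rank; apply: omegaP.
Qed.

(** As [alpha] is onto, each white half-edge is the re-entry after some arc, so [next_arc]
    determines [cw] there. *)
Lemma next_arc_cw N (d : N) : ~~ black d -> exists t,
  [/\ ty d = ordS (alpha t (bud_types N (lab d)))
    & (ty (cw N d), lab (cw N d)) = next_arc N (t, lab d)].
Proof.
move=> wd; have [t tE] := alpha_onto (bud_types N (lab d)) (ord_pred (ty d)).
exists t; rewrite tE ord_predK; split=> //.
by rewrite /next_arc /= tE ord_predK corner_onto.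
Qed.

(** The isomorphism keeps colour, type and label. It commutes with [opp] because the bud types
    agree, and with [cw] at white vertices because both tours have the same exit orders and so
    coincide. *)
Lemma Psi_inj (k_gt0 : 0 < k) (n_gt0 : 0 < n) N N' : Psi N = Psi N' -> nebula_iso N N'.
Proof.
move=> eqPsi; have eqR i : bud_types N i = bud_types N' i.
  by have /(congr1 snd)/ffunP/(_ i) := eqPsi; rewrite !ffunE.
have eq_next : next_arc N =1 next_arc N'.
  have := eulerian_rank N' k_gt0 n_gt0; rewrite -eqPsi.
  exact: eulerian_uniq (eulerian_rank N k_gt0 n_gt0).
have eq_root : root_label N = root_label N'.
  have := root_indexE N' k_gt0 n_gt0; rewrite -eqPsi -(root_indexE N k_gt0 n_gt0).
  by case.
pose f (M M' : lrnebula n p) (d : M) : M' := dart_of M' (black d) (ty d, lab d).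
have fP (M M' : lrnebula n p) (d : M) :
    [/\ black (f M M' d) = black d, ty (f M M' d) = ty d & lab (f M M' d) = lab d].
  exact: dart_ofP.
have fK (M M' : lrnebula n p) : cancel (f M M') (f M' M).
  by move=> d; have [b t l] := fP M M' d; rewrite [LHS]/f b t l dart_ofK.
exists (f N N'); split=> [|||d|].
- by exists (f N' N); apply: fK.
- split=> d; have [bf tf lf] := fP N N' d; last first.
    have [bo to lo] := fP N N' (opp N d).
    apply: dart_uniq; rewrite ?bo ?to ?lo ?ty_edge ?lab_edge ?tf ?lf //.
    have : (opp N d == d) = (opp N' (f N N' d) == f N N' d).
      by rewrite !bud_typesE tf lf eqR.
    have [-> /esym/eqP->//|edge /esym/negbT edge'] := eqVneq (opp N d) d.
    by rewrite !edge_bipartite ?bf.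
  have [bc tc lc] := fP N N' (cw N d).
  have [bd|wd] := boolP (black d).
    apply: dart_uniq; rewrite ?bc ?tc ?lc ?black_vertex //.
      by rewrite !black_rotation ?bf ?tf.
    by rewrite !lab_vertex ?bf ?lf.
  have wf : ~~ black (f N N' d) by rewrite bf.
  have [t [td nd]] := next_arc_cw wd; have [t' [td' nd']] := next_arc_cw wf.
  move: td'; rewrite tf lf -eqR td => /(@ordS_inj _)/alpha_inj eq_t.
  move: nd'; rewrite lf -eq_t -eq_next -nd => -[t_cw l_cw].
  by apply: dart_uniq; rewrite ?bc ?tc ?lc ?black_vertex.
- by split=> d; have [] := fP N N' d.
- by have [] := fP N N' d.
apply/setP=> d; have [bd td ld] := fP N' N d.
rewrite -{1}(fK _ N d) mem_imset; last exact: can_inj (fK N N').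
by rewrite !mem_root bd ld eq_root.
Qed.

End Isomorphism.

(** * The nebula of a valid bidding *)

Section Construction.
Variables (k n : nat) (p : 'I_k -> nat) (k_gt0 : 0 < k) (n_gt0 : 0 < n).
Variable B : prebidding k n.
Hypothesis B_bidding : is_bidding p B.
Variables (phi : {perm 'I_k * 'I_n}) (rk : 'I_k * 'I_n -> nat).
Hypothesis phi_rk :
  eulerian_order n_gt0 B.1 (arc_target B) (ord_last k_gt0) phi rk.

Local Notation arc := ('I_k * 'I_n)%type.

Lemma target_arc_inj : injective (fun x : arc => (arc_target B x, x.2)).
Proof. by move=> [t i] [t' i'] [+ eq_i]; rewrite /arc_target /= eq_i => /alpha_inj->. Qed.

(* The half-edge of type t, seen from its black (true) or white (false) vertex,
   with the label i of its edge or bud. *)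
Definition half : finType := (bool * arc)%type.

Definition half_opp (d : half) : half :=
  if d.2.1 \in B.2 d.2.2 then d else (~~ d.1, d.2).

(** On the white side, [next_arc] solved for [cw]: the inverse permutation finds the arc after which
    the walk re-enters through [d], and [phi] gives the corner to come next. White vertices are
    whatever cycles result. *)
Definition half_cw (d : half) : half :=
  if d.1 then (true, (ordS d.2.1, d.2.2))
  else (false, phi ((perm target_arc_inj)^-1%g (ord_pred d.2.1, d.2.2))).

Lemma half_oppK : involutive half_opp.
Proof.
by case=> b x; rewrite /half_opp /=; case xR: (x.1 \in _); rewrite /= xR ?negbK.
Qed.

Lemma half_cw_inj : injective half_cw.
Proof.
case=> [b [t i]] [b' [t' i']]; rewrite /half_cw /=; case: b; case: b' => // /(congr1 snd) /=.
  move=> eq_d; have /= /(@ordS_inj k)-> := congr1 fst eq_d.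
  by have /= -> := congr1 snd eq_d.
move=> /perm_inj/perm_inj eq_d; have /= /(can_inj (@ord_predK k))-> := congr1 fst eq_d.
by have /= -> := congr1 snd eq_d.
Qed.

Let opp_perm : {perm half} := perm (inv_inj half_oppK).
Let cw_perm : {perm half} := perm half_cw_inj.
Let face : half -> half := (opp_perm * cw_perm)%g.

Lemma half_bud d : (half_opp d == d) = (d.2.1 \in B.2 d.2.2).
Proof.
case: d => b x; rewrite /half_opp /=; case: ifP => _; first by rewrite eqxx.
by rewrite xpair_eqE; case: b.
Qed.

Let half_opp2 d : (half_opp d).2 = d.2.
Proof. by rewrite /half_opp; case: ifP. Qed.

Let half_opp1 d : half_opp d != d -> (half_opp d).1 = ~~ d.1.
Proof. by rewrite half_bud /half_opp => /negbTE->. Qed.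

Let half_cw1 d : (half_cw d).1 = d.1.
Proof. by rewrite /half_cw; case: ifP. Qed.

Let half_cw_ty (d : half) : d.1 -> (half_cw d).2.1 = ordS d.2.1.
Proof. by rewrite /half_cw => ->. Qed.

Let half_cw_lab (d : half) : d.1 -> (half_cw d).2.2 = d.2.2.
Proof. by rewrite /half_cw => ->. Qed.

Let half_opp_ty d : (half_opp d).2.1 = d.2.1. Proof. by rewrite half_opp2. Qed.
Let half_opp_lab d : (half_opp d).2.2 = d.2.2. Proof. by rewrite half_opp2. Qed.

Let faceE m d : iter m face d = iter m (fun d => half_cw (half_opp d)) d.
Proof. by apply: eq_iter => e; rewrite /face permM !permE. Qed.

Lemma face_white x : fconnect face (false, x) (false, phi x).
Proof.
have [m [[b [t i]] [itE /= wv iE tE _]]] := face_next_white (black := fun d : half => d.1)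
  half_cw1 half_opp_ty half_opp_lab half_opp1 half_cw_ty half_cw_lab half_bud
  (isT : ~~ (false, x).1).
have := fconnect_iter face m.+1 (false, x); rewrite faceE itE /half_cw /= (negbTE wv).
rewrite tE iE ordSK /= (_ : (_, _) = perm target_arc_inj x) ?permK //.
by rewrite permE.
Qed.

Lemma face_to_white d : exists x, fconnect face d (false, x).
Proof.
have [/(_ d.2.2)/properP[_ [t _ tR]] _] := B_bidding.
have [m mE] := iter_ordS_onto d.2.1 t; rewrite -mE in tR.
have [s] := face_reaches_white (black := fun d : half => d.1) half_cw1
  half_opp1 half_cw_ty half_cw_lab half_bud tR.
rewrite -faceE; have := fconnect_iter face s d.
by case: (iter s face d) => [[] x] //= dx _; exists x.
Qed.

(** The face follows [phi] through all white corners, and every half-edge leads to one of them. This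
    gives the single face, and connectedness as well, since a face step is made of [opp] and
    [cw]. *)
Lemma face_total d e : fconnect face d e.
Proof.
pose c : half := (false, phi (last_arc n_gt0 B.1 (ord_last k_gt0))).
have white x : fconnect face c (false, x).
  elim/(eulerian_ind phi_rk): x => [|x _ cx]; first exact: connect0.
  exact: connect_trans cx (face_white x).
have sym := fconnect_sym (@perm_inj _ (opp_perm * cw_perm)%g).
have to_c f : fconnect face f c.
  by have [x fx] := face_to_white f; apply: connect_trans fx _; rewrite sym.
by apply: connect_trans (to_c d) _; rewrite sym.
Qed.

Lemma half_connected (x y : half) :
  connect (fun a b => (b == cw_perm a) || (b == opp_perm a)) x y.
Proof.
have := face_total x y; apply: connect_sub => u v /eqP<-.
rewrite /face permM; apply: (@connect_trans _ _ (opp_perm u)); apply: connect1;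
by rewrite eqxx ?orbT.
Qed.

Lemma opp_permK : involutive opp_perm.
Proof. by move=> d; rewrite !permE half_oppK. Qed.

Definition half_map : budmap := BudMap opp_permK half_connected.

Lemma half_one_face : #|faces half_map| = 1.
Proof.
pose c : half := (false, (ord_last k_gt0, ord_last n_gt0)).
apply/eqP/cards1P; exists (porbit (face_perm half_map) c); apply/setP=> F; rewrite inE.
apply/imsetP/eqP=> [[d _ ->]|->]; last by exists c.
apply/eqP; rewrite eq_porbit_mem; apply/porbitP.
by exists (findex face c d); rewrite permX iter_findex // face_total.
Qed.

Let half_buds (b : bool) t :
  [set (b, (t, i)) | i in [set i | t \in B.2 i]]
  = [set d : half_map | [&& is_bud d, d.1 == b & d.2.1 == t]].
Proof.
apply/setP=> -[b' [t' i]]; rewrite inE /is_bud /= permE half_bud /=.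
apply/imsetP/and3P=> [[j]|[tR /eqP-> /eqP tE]].
  by rewrite inE => tR [-> -> ->].
by exists i; rewrite ?inE -?tE.
Qed.

Let card_half_buds b t : #|[set d : half_map | [&& is_bud d, d.1 == b & d.2.1 == t]]| = p t.
Proof. by rewrite -half_buds card_imset ?B_bidding.2 // => i j []. Qed.

Let half_black_buds t :
  [set d : half_map | [&& is_bud d, d.1 & d.2.1 == t]]
  = [set d : half_map | [&& is_bud d, d.1 == true & d.2.1 == t]].
Proof. by apply/setP=> d; rewrite !inE eqb_id. Qed.

Let half_white_buds t :
  [set d : half_map | [&& is_bud d, ~~ d.1 & d.2.1 == t]]
  = [set d : half_map | [&& is_bud d, d.1 == false & d.2.1 == t]].
Proof. by apply/setP=> d; rewrite !inE eqbF_neg. Qed.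

Lemma half_balanced t :
  #|[set d : half_map | [&& is_bud d, d.1 & d.2.1 == t]]|
  = #|[set d : half_map | [&& is_bud d, ~~ d.1 & d.2.1 == t]]|.
Proof. by rewrite half_black_buds half_white_buds !card_half_buds. Qed.

Definition black_star (i : 'I_n) : {set half_map} := [set (true, (t, i)) | t : 'I_k].

Let star_memE i d : (d \in black_star i) = d.1 && (d.2.2 == i).
Proof.
apply/imsetP/andP=> [[t _ ->]|]; first by [].
by case: d => b [t j] /= [-> /eqP->]; exists t.
Qed.

Let half_vertex (d : half_map) : d.1 -> vertex_of d = black_star d.2.2.
Proof.
move=> bd; have itE m : iter m (cw half_map) d = (true, (iter m (@ordS k) d.2.1, d.2.2)).
  elim: m => [|m IHm] /=; first by case: d bd => -[] // [].
  by rewrite IHm permE.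
apply/setP=> e; rewrite star_memE; apply/porbitP/andP=> [[m ->]|[]].
  by rewrite permX itE.
case: e => b [t i] /= -> /eqP->; have [m mE] := iter_ordS_onto d.2.1 t.
by exists m; rewrite permX itE mE.
Qed.

Lemma half_black_degree (d : half_map) : d.1 -> #|vertex_of d| = k.
Proof. by move=> bd; rewrite half_vertex // card_imset ?card_ord // => t t' []. Qed.

Definition half_nebula : nebula k.
Proof.
refine (@Nebula k half_map half_one_face (fun d => d.1) _ (fun d => d.2.1) _ _
  half_black_degree _ _ half_balanced).
- by move=> d; rewrite permE half_cw1.
- by move=> d; rewrite permE half_opp_ty.
- by move=> d; rewrite /is_bud permE => /half_opp1.
- by move=> d bd; rewrite permE half_cw_ty.
(* White rotation: the source of [phi x] is the target of [x], and [x] was chosen with the preceding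
   type as target. *)
move=> d wd; rewrite permE /half_cw (negbTE wd) /=; case: phi_rk => _ -> _ _ _.
set x := ((perm target_arc_inj)^-1)%g _.
have : perm target_arc_inj x = (ord_pred d.2.1, d.2.2) by rewrite permKV.
by rewrite permE => -[].
Defined.

Let stars : black_vertices half_nebula = [set black_star i | i : 'I_n].
Proof.
apply/setP=> W; apply/imsetP/imsetP=> [[d]|[i _ ->]].
  by rewrite inE => bd ->; exists d.2.2; rewrite // half_vertex.
by exists (true, (ord_last k_gt0, i)); rewrite ?inE // half_vertex.
Qed.

Lemma half_size : has_size half_nebula n.
Proof.
rewrite /has_size stars card_imset ?card_ord // => i j /setP/(_ (true, (ord_last k_gt0, i))).
by rewrite !star_memE /= eqxx => /esym/eqP.
Qed.

Lemma half_type : has_type half_nebula p.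
Proof. by move=> t; rewrite /has_type /black_buds half_black_buds card_half_buds. Qed.

(** The root is forced: its label must be that of the last exit from k. *)
Definition bidding_nebula : lrnebula n p.
Proof.
refine (@LRNebula k n p half_nebula half_size half_type
  (black_star (B.1 (ord_last k_gt0) (ord_last n_gt0))) _ (fun d => d.2.2) _ _ _ _ _).
- by rewrite stars imset_f.
- by move=> d bd; rewrite permE half_cw_lab.
- by move=> d e bd be eq_l; rewrite !half_vertex // eq_l.
- by move=> d; rewrite permE half_opp_lab.
- move=> t [b [u i]]; rewrite inE /is_bud /= permE half_bud /= => /and3P[uR _ /eqP tE].
  apply/imsetP; exists (true, (t, i)) => //.
  by rewrite inE /is_bud /= permE half_bud /= -{1}tE uR eqxx.
move=> t [b [u i]] [b' [u' i']]; rewrite !inE /= => /and3P[_ /negbTE-> /eqP->].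
by move=> /and3P[_ /negbTE-> /eqP->] /= ->.
Defined.

Lemma corner_bidding x : corner bidding_nebula x = (false, x).
Proof. by case: x => t i; apply: (@corner_onto _ _ _ bidding_nebula (false, (t, i))). Qed.

Lemma bud_types_bidding i : bud_types bidding_nebula i = B.2 i.
Proof.
apply/setP=> t.
by rewrite -[LHS](bud_typesE (N := bidding_nebula) (true, (t, i))) /= permE half_bud.
Qed.

Lemma next_arc_bidding x : next_arc bidding_nebula x = phi x.
Proof.
rewrite /next_arc corner_bidding bud_types_bidding /= permE /half_cw /= ordSK.
have <- : perm target_arc_inj x = (alpha x.1 (B.2 x.2), x.2) by rewrite permE.
by rewrite permK; case: (phi x).
Qed.

Lemma root_index_bidding :
  root_index bidding_nebula = last_arc n_gt0 B.1 (ord_last k_gt0).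
Proof.
congr (_, _); first exact: val_inj.
have rl : (true, (ord_last k_gt0, B.1 (ord_last k_gt0) (ord_last n_gt0)))
   \in Defs.root bidding_nebula by rewrite star_memE /= eqxx.
by rewrite -(root_labelP rl).
Qed.

Lemma Psi_bidding_nebula : Psi bidding_nebula = B.
Proof.
have Er := eulerian_rank bidding_nebula k_gt0 n_gt0.
(* The permutations in [Psi] are not known yet, but their last exit from k is the root index, which
   is. *)
have next_last : next_arc bidding_nebula (last_arc n_gt0 (Psi bidding_nebula).1 (ord_last k_gt0))
    = phi (last_arc n_gt0 B.1 (ord_last k_gt0)).
  by rewrite -root_indexE root_index_bidding next_arc_bidding.
have eq_pos x : pos (rank bidding_nebula) x = pos rk x.
  elim/(eulerian_ind phi_rk): x => [|x xr IHx].
    by rewrite (pos_first phi_rk) -next_last (pos_first Er).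
  rewrite (pos_phi phi_rk) // -next_arc_bidding (pos_phi Er) ?IHx //.
  by rewrite -root_indexE root_index_bidding.
have rank_mono x y : (rank bidding_nebula x < rank bidding_nebula y) = (rk x < rk y).
  by rewrite -[LHS]pos_mono -[RHS]pos_mono !eq_pos.
rewrite [RHS]surjective_pairing /Psi; congr (_, _); apply/ffunP=> t; rewrite ffunE; last first.
  exact: bud_types_bidding.
apply: (sorting_perm_uniq (key := fun i => rank bidding_nebula (t, i)))
  => [i j /rank_inj[]//|i j|i j lt_ij].
  exact: omegaP.
by rewrite rank_mono; case: phi_rk => _ _ _ _; apply.
Qed.

End Construction.

(** Each label i gives exactly one arc into v, [alpha] being a bijection for fixed R_i. *)
Lemma target_indegree k n (B : prebidding k n) v : #|[set x | arc_target B x == v]| = n.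
Proof.
pose f i : 'I_k * 'I_n := ((perm (@target_arc_inj _ _ B))^-1%g (v, i)).
have f_inj : injective f by move=> i j /perm_inj[].
rewrite -[RHS](card_ord n) -cardsT -(card_imset _ f_inj); apply: eq_card => x; rewrite inE.
apply/eqP/imsetP=> [xv|[i _ ->]].
  exists x.2; rewrite // /f.
  have <- : perm (@target_arc_inj _ _ B) x = (v, x.2) by rewrite permE xv.
  by rewrite permK.
have : perm (@target_arc_inj _ _ B) (f i) = (v, i) by rewrite permKV.
by rewrite permE => -[].
Qed.

Theorem theorem6p2 (k n : nat) (p : 'I_k -> nat)
    (k_ge2 : 2 <= k) (n_gt0 : 0 < n) (p_gt0 : forall t : 'I_k, 0 < p t) :
  [/\ forall N : lrnebula n p, valid_bidding n_gt0 p (Psi N),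
      forall N N' : lrnebula n p, nebula_iso N N' -> Psi N = Psi N',
      forall N N' : lrnebula n p, Psi N = Psi N' -> nebula_iso N N'
    & forall B : prebidding k n, valid_bidding n_gt0 p B ->
        exists N : lrnebula n p, Psi N = B].
Proof.
have k_gt0 : 0 < k := ltnW k_ge2.
split=> [N|N N'|N N'|B B_valid].
- exact: Psi_valid.
- exact: Psi_iso.
- exact: Psi_inj.
have [phi [rk phi_rk]] := eulerian_order_exists (target_indegree B) (valid_lead k_gt0 B_valid).
by exists (bidding_nebula B_valid.1 phi_rk); apply: Psi_bidding_nebula.
Qed.
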